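(* Fix $d>1/2$ and $p\in(0,1)$, write $\overline{p}=1-p$, and for each positive integer $q$ let $N$ satisfy $N+1=dq$. Consider the random Bernoulli quota complex on $N+1$ vertices with quota $q$ and Bernoulli probability $p$, let $m_{\mathrm{peak}}$ be the value of $m$ at which the mode of $m\mapsto\mathbb{E}[\widetilde{\beta}_m]$ is attained, let $\tau_{\mathrm{peak}}=\frac{m_{\mathrm{peak}}+1}{q}$, and let $\tau_\infty=\lim_{q\to\infty}\tau_{\mathrm{peak}}$. If $p\neq 3-\sqrt{8}$, then $\tau_\infty$ is the solution with $\frac12\le\tau_\infty<1$ of the quadratic equation $$\tau_{\infty}^2(\overline{p}^2-4p) + \tau_{\infty}\left(4p-\overline{p}^2(d+1)\right) +\overline{p}^2d-p=0.$$ If $p=3-\sqrt{8}$, then $\tau_\infty=\dfrac{4d-1}{4d}$.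
   Context: Quota complex: given vertices with weights $w(v)>0$ and a quota $q>0$, the quota complex is the simplicial complex on these vertices in which a face $F=[v_{i_0},\dots,v_{i_n}]$ is included if and only if $w(F):=\sum_{k=0}^n w(v_{i_k})<q$. Random Bernoulli quota complex: let $X_1,\dots,X_N$ be i.i.d. Bernoulli random variables with $\mathbb{P}[X_j=1]=p$ and $\mathbb{P}[X_j=0]=1-p$; vertex $v_0$ has fixed weight $W_0=1$ and vertex $v_j$ has weight $W_j=1+X_j$ for $j=1,\dots,N$; the complex is the quota complex with these weights and quota $q$ (an integer). $\widetilde{\beta}_m$ denotes the reduced $m$-th Betti number of this complex with real coefficients. *)

(* Defs.v *)
From HB Require Import structures.
From mathcomp Require Import all_boot all_order all_algebra.
From mathcomp Require Import all_classical all_reals all_analysis.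

Set Implicit Arguments.
Unset Strict Implicit.
Unset Printing Implicit Defensive.

Import Order.TTheory GRing.Theory Num.Theory.
Import numFieldNormedType.Exports.

Local Open Scope ring_scope.

(* A simplicial complex on the vertices 0 < ... < n-1 is given by its set
   K : {set {set 'I_n}} of faces, the empty face included; an m-dimensional
   face has m + 1 vertices. *)

Definition faces (n : nat) (K : {set {set 'I_n}}) (k : nat) :
  {set {set 'I_n}} := [set F in K | #|F| == k]%SET.

(* The coefficient of G in the boundary of F, namely (-1) ^ i if G is obtained
   from F by deleting its i-th vertex (counting from 0), and 0 otherwise. *)
Definition incidence (R : fieldType) (n : nat) (F G : {set 'I_n}) : R :=
  \sum_(v in F | (F :\ v)%SET == G) (-1) ^+ #|[set u in F | (u < v)%N]%SET|.

(* The matrix, acting on row vectors, of the boundary operator from chains on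
   faces with k + 1 vertices to chains on faces with k vertices. For k = 0 it
   is the augmentation map onto the span of the empty face. *)
Definition boundary (R : fieldType) (n : nat) (K : {set {set 'I_n}}) (k : nat) :
  'M[R]_(#|faces K k.+1|, #|faces K k|) :=
  \matrix_(i, j) incidence R (enum_val i) (enum_val j).

(* dim Z_m - dim B_m: the row space of kermx is the space of m-cycles, that of
   boundary K m.+1 is the space of m-boundaries. *)
Definition reduced_betti (R : fieldType) (n : nat) (K : {set {set 'I_n}})
    (m : nat) : nat :=
  (\rank (kermx (boundary R K m)) - \rank (boundary R K m.+1))%N.

Definition quota_complex (R : realFieldType) (n : nat) (w : 'I_n -> R) (q : R) :
  {set {set 'I_n}} := [set F : {set 'I_n} | \sum_(v in F) w v < q]%SET.

(* W_0 = 1 and W_j = 1 + X_j; the index j : 'I_N of X stands for j + 1. *)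
Definition bernoulli_weight (R : realFieldType) (N : nat) (x : 'I_N -> R)
    (v : 'I_N.+1) : R :=
  if unlift ord0 v is Some j then 1 + x j else 1.

Definition is_bernoulli (d : measure_display) (T : measurableType d)
    (R : realType) (P : probability T R) (p : R) (X : {RV P >-> R}) : Prop :=
  P (X @^-1` [set 1])%classic = p%:E /\
  P (X @^-1` [set 0])%classic = (1 - p)%:E.

Definition mutually_independent (d : measure_display) (T : measurableType d)
    (R : realType) (P : probability T R) (N : nat) (X : 'I_N -> {RV P >-> R}) :
    Prop :=
  forall (J : {set 'I_N}) (B : 'I_N -> set R),
    (forall j, measurable (B j)) ->
    P (\bigcap_(j in [set` J]) (X j @^-1` B j))%classic =
      (\prod_(j in J) P (X j @^-1` B j)%classic)%E.

Definition expected_betti (d : measure_display) (T : measurableType d)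
    (R : realType) (P : probability T R) (N : nat) (X : 'I_N -> {RV P >-> R})
    (q m : nat) : \bar R :=
  ('E_P[fun t => (reduced_betti R
     (quota_complex (bernoulli_weight (fun j => X j t)) q%:R) m)%:R])%E.

Definition is_mode (R : realType) (f : nat -> \bar R) (m : nat) : Prop :=
  forall k, (f k <= f m)%E.

Definition peak_quadratic (R : realType) (d p tau : R) : R :=
  let pbar := 1 - p in
  tau ^+ 2 * (pbar ^+ 2 - 4 * p) + tau * (4 * p - pbar ^+ 2 * (d + 1))
    + pbar ^+ 2 * d - p.

(* Main.v *)
Require Import Defs.
From HB Require Import structures.
From mathcomp Require Import all_boot all_order all_algebra.
From mathcomp Require Import all_classical all_reals all_analysis.
From mathcomp Require Import measurable_realfun ring lra zify.

(** The vertex [v_0] has minimal weight, so the quota complex is the cone over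
    part of itself with apex [v_0] together with faces glued along their whole
    boundary; its reduced Betti number in dimension [m] therefore counts the
    faces [F] of [m + 1] vertices avoiding [v_0] with [q - 1 <= w(F) < q]. For
    weights in {1, 2} this means [w(F) = q - 1], so with [k = m + 1] and
    [j = q - 1 - k] the expectation is [C(N, k) C(k, j) p^j (1 - p)^(k - j)].
    The ratio of the values at [k + 1] and [k] is
      [(1 - p)^2 (N - k) (q - 1 - k) / (p (2k - q + 2) (2k - q + 3))],
    which crosses 1 at a mode; dividing by [q^2], the peak quadratic at
    [k / q] is [O(1 / q)]. The quadratic is positive at [1/2] and negative at
    [1], so it has a single root between them, and there it crosses 0 with
    nonzero slope, hence [k / q] converges to that root. *)

Set Implicit Arguments.
Unset Strict Implicit.
Unset Printing Implicit Defensive.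

Import Order.TTheory GRing.Theory Num.Theory.
Import numFieldNormedType.Exports.

Local Open Scope ring_scope.

(** * Homology of quota complexes *)

Lemma incidence_eq0 (R : fieldType) (n : nat) (F G : {set 'I_n}) :
  (forall v, v \in F -> (F :\ v)%SET != G) -> incidence R F G = 0.
Proof.
move=> FG; rewrite /incidence big_pred0 // => v.
by apply/negbTE/negP => /andP[/FG /negP].
Qed.

Lemma setD1_injl (T : finType) (F : {set T}) (u v : T) :
  u \in F -> (F :\ u = F :\ v)%SET -> u = v.
Proof.
move=> uF /setP /(_ u); rewrite !inE uF eqxx /= andbT => /esym/negbT.
by rewrite negbK => /eqP.
Qed.

Lemma incidence_setD1 (R : fieldType) (n : nat) (F : {set 'I_n}) (v : 'I_n) :
  v \in F ->
  incidence R F (F :\ v)%SET = (-1) ^+ #|[set u in F | (u < v)%N]%SET|.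
Proof.
move=> vF; rewrite /incidence (big_pred1 v) // => u.
apply/andP/eqP => [[uF /eqP /setD1_injl] | ->]; first exact.
by split.
Qed.

Lemma incidence_neq0 (R : fieldType) (n : nat) (F G : {set 'I_n}) :
  incidence R F G != 0 -> exists2 v, v \in F & G = (F :\ v)%SET.
Proof.
move=> FG0.
have /existsP[v /andP[vF /eqP <-]] :
    [exists v, (v \in F) && ((F :\ v)%SET == G)].
  apply: contraNT FG0; rewrite negb_exists => /forallP FG.
  apply/eqP/incidence_eq0 => v vF.
  by have := FG v; rewrite vF.
by exists v.
Qed.

(* Deleting u < v shifts the position of v by one and fixes that of u. *)
Lemma boundary_sign_anticomm (R : fieldType) (n : nat) (F : {set 'I_n})
    (u v : 'I_n) : u \in F -> v \in F -> (u < v)%N ->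
  (-1) ^+ #|[set x in F | (x < u)%N]%SET| *
    (-1) ^+ #|[set x in (F :\ u)%SET | (x < v)%N]%SET| =
  - ((-1) ^+ #|[set x in F | (x < v)%N]%SET| *
    (-1) ^+ #|[set x in (F :\ v)%SET | (x < u)%N]%SET|) :> R.
Proof.
move=> uF vF uv.
have -> : [set x in (F :\ v)%SET | (x < u)%N]%SET = [set x in F | (x < u)%N]%SET.
  apply/setP => x; rewrite !inE; case: ltnP => xu; rewrite ?andbF ?andbT //.
  by case: eqP => // xv; move: xu; rewrite xv ltnNge (ltnW uv).
rewrite (cardsD1 u [set x in F | (x < v)%N]%SET) !inE uF uv add1n exprS.
have -> : ([set x in F | (x < v)%N] :\ u = [set x in F :\ u | (x < v)%N])%SET.
  by apply/setP => x; rewrite !inE andbA.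
by rewrite mulN1r mulNr opprK mulrC.
Qed.

(** The sum runs over all sets, since below it is applied to a set that may fail to be a face. Its
    terms correspond to ordered pairs of deleted vertices, and swapping a pair flips the sign. *)
Lemma incidence_comp (R : realFieldType) (n : nat) (F H : {set 'I_n}) :
  \sum_(G : {set 'I_n}) incidence R F G * incidence R G H = 0.
Proof.
pose s (A : {set 'I_n}) (v : 'I_n) : R :=
  (-1) ^+ #|[set x in A | (x < v)%N]%SET|.
pose P (u v : 'I_n) := [&& u \in F, v \in F, u != v & (F :\ u :\ v)%SET == H].
pose S := \sum_u \sum_(v | P u v) s F u * s (F :\ u)%SET v.
have -> : \sum_(G : {set 'I_n}) incidence R F G * incidence R G H = S.
  transitivity (\sum_(u in F) s F u * incidence R (F :\ u)%SET H).
    rewrite /incidence.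
    under eq_bigr do rewrite big_mkcondr mulr_suml.
    rewrite exchange_big /=; apply: eq_bigr => u uF.
    rewrite (bigD1 (F :\ u)%SET) //= eqxx [X in _ + X]big1 ?addr0 //.
    move=> G /negbTE GF.
    by rewrite eq_sym GF mul0r.
  rewrite /S big_mkcond; apply: eq_bigr => u _.
  case: ifP => uF; last by rewrite big_pred0 // => v; rewrite /P uF.
  rewrite /incidence mulr_sumr; apply: eq_bigl => v.
  by rewrite /P uF !inE /= (eq_sym v); case: (u == v); rewrite ?andbF.
have anti : S = - S.
  rewrite {1}/S (exchange_big_dep predT) //= /S -sumrN; apply: eq_bigr => u _.
  rewrite -sumrN; apply: eq_big => [v|v /and4P[vF uF vu _]].
    rewrite /P (eq_sym v) andbCA.
    suff -> : (F :\ v :\ u = F :\ u :\ v)%SET by [].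
    by apply/setP => x; rewrite !inE andbCA.
  case: (ltngtP u v) => uv.
  - by rewrite /s (boundary_sign_anticomm R uF vF uv) opprK.
  - by rewrite /s (boundary_sign_anticomm R vF uF uv).
  - by move: vu; rewrite (val_inj uv) eqxx.
by lra.
Qed.

(* When [v0] can replace any vertex of any face, the rows indexed by the
   faces through [v0] form a basis of the row space: they are independent since
   [F :\ v0] is the only face of [F] avoiding [v0], and they span since
   [d (d (v0 |: F)) = 0] even when [v0 |: F] is not a face. *)
Lemma rank_boundary_shifted (R : realFieldType) (n : nat) (K : {set {set 'I_n}})
    (v0 : 'I_n) (k : nat) :
  (forall F v, F \in K -> v \in F -> (F :\ v)%SET \in K) ->
  (forall F v, F \in K -> v \in F -> v0 \notin F ->
     (v0 |: F :\ v)%SET \in K) ->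
  \rank (boundary R K k) = #|[set F in faces K k.+1 | v0 \in F]%SET|.
Proof.
move=> Kdown Kshift.
set S := [set F in faces K k.+1 | v0 \in F]%SET.
pose B : 'M[R]_(#|S|, #|faces K k|) :=
  \matrix_(i, j) incidence R (enum_val i) (enum_val j).
have SK (F : {set 'I_n}) : F \in S -> F \in faces K k.+1.
  by rewrite inE => /andP[].
have Sv0 (F : {set 'I_n}) : F \in S -> v0 \in F.
  by rewrite inE => /andP[].
have faceD1 (F : {set 'I_n}) v : F \in faces K k.+1 -> v \in F ->
    (F :\ v)%SET \in faces K k.
  rewrite !inE => /andP[FK /eqP Fk] vF; rewrite Kdown //=.
  by move: Fk; rewrite (cardsD1 v) vF add1n => -[->].
have BA : (B <= boundary R K k)%MS.
  apply/row_subP => i.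
  have iK := SK _ (enum_valP i).
  suff -> : row i B = row (enum_rank_in iK (enum_val i)) (boundary R K k).
    exact: row_sub.
  by apply/rowP => j; rewrite !mxE enum_rankK_in.
have AB : (boundary R K k <= B)%MS.
  apply/row_subP => i.
  have := enum_valP i; set F := enum_val i => FK.
  have [v0F|v0F] := boolP (v0 \in F).
    have FS : F \in S by rewrite inE FK.
    suff -> : row i (boundary R K k) = row (enum_rank_in FS F) B.
      exact: row_sub.
    by apply/rowP => j; rewrite !mxE enum_rankK_in.
  (* [G] need not be a face; d(d [G]) = 0 still expresses the row of [F] through the rows of the
     other facets of [G]. *)
  pose G := (v0 |: F)%SET.
  have v0G : v0 \in G by rewrite !inE eqxx.
  have GD1 : (G :\ v0 = F)%SET by rewrite /G finset.setU1K.
  have GF0 : incidence R G F != 0.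
    by rewrite -[X in incidence R G X]GD1 incidence_setD1 // signr_eq0.
  have FS : F \notin S by apply: contra v0F => /Sv0.
  pose c : 'rV[R]_#|S| :=
    \row_s (- (incidence R G F)^-1 * incidence R G (enum_val s)).
  suff -> : row i (boundary R K k) = c *m B by exact: submxMl.
  apply/rowP => j; rewrite !mxE -/F; set H := enum_val j.
  have := incidence_comp R G H.
  rewrite (bigD1 F) //= (bigID (mem S)) /= [X in _ + (_ + X)]big1 ?addr0.
    move=> E; apply: (mulfI GF0).
    under eq_bigr do rewrite !mxE.
    rewrite -(big_enum_val (fun F' =>
      - (incidence R G F)^-1 * incidence R G F' * incidence R F' H)) /=.
    under eq_bigr do rewrite mulNr mulNr -mulrA.
    rewrite sumrN -mulr_sumr mulrN mulVKf //.
    move/eqP: E; rewrite addr_eq0 => /eqP ->; congr (- _).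
    apply: eq_bigl => F'; apply: andb_idl => F'S.
    by apply: contra FS => /eqP <-.
  (* A facet of [G] other than [F] contains [v0], so [Kshift] puts it in [S]; no other terms
     survive. *)
  move=> F' /andP[F'F F'S].
  case: (eqVneq (incidence R G F') 0) => [->|]; first by rewrite mul0r.
  move/incidence_neq0 => [v vG F'E]; case/negP: F'S.
  have vv0 : v != v0 by apply: contra F'F => /eqP vv0; rewrite F'E vv0 GD1.
  have vF : v \in F by move: vG; rewrite !inE (negbTE vv0).
  have F'E2 : F' = (v0 |: F :\ v)%SET.
    rewrite F'E; apply/setP => x; rewrite !inE.
    by case: (eqVneq x v0) => [->|]; rewrite ?(eq_sym v0) ?vv0.
  move: FK; rewrite !inE F'E2 !inE eqxx andbT => /andP[FK /eqP Fk].
  by rewrite Kshift //= cardsU1 !inE (negbTE v0F) andbF -Fk (cardsD1 v F) vF.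
have -> : \rank (boundary R K k) = \rank B.
  by apply: eqmx_rank; apply/andP.
(* [E] is a right inverse of [B]: among faces avoiding [v0], the row of [F] is nonzero only at
   [F :\ v0], where its entry is a sign, of square 1. *)
pose E : 'M[R]_(#|faces K k|, #|S|) :=
  \matrix_(j, i) ((v0 \notin (enum_val j : {set 'I_n}))%:R *
     incidence R (enum_val i) (enum_val j)).
suff BE : B *m E = 1%:M.
  by apply/eqP; rewrite -[_ == _]/(row_free B); apply/row_freeP; exists E.
apply/matrixP => i i'; rewrite !mxE.
under eq_bigr do rewrite !mxE.
have := enum_valP i; have := enum_valP i'.
rewrite -(inj_eq enum_val_inj); set F := enum_val i; set F' := enum_val i'.
move=> F'S FS.
rewrite -(big_enum_val (fun G : {set 'I_n} =>
  incidence R F G * ((v0 \notin G)%:R * incidence R F' G))) /=.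
have face0 := faceD1 _ _ (SK _ FS) (Sv0 _ FS).
rewrite (bigD1 (F :\ v0)%SET) //= [X in _ + X]big1 ?addr0; last first.
  move=> G /andP[GK GF].
  case: (eqVneq (incidence R F G) 0) => [->|]; first by rewrite mul0r.
  move/incidence_neq0 => [v vF GE].
  have v0G : v0 \in G.
    rewrite GE !inE Sv0 // andbT; apply: contra GF => /eqP ->.
    by rewrite GE.
  by rewrite v0G mul0r mulr0.
rewrite !inE eqxx mul1r.
case: (eqVneq F F') => [<-|FF'].
  by rewrite incidence_setD1 ?Sv0 // -expr2 sqrr_sign.
rewrite [X in _ * X]incidence_eq0 ?mulr0 // => v vF'.
apply: contra FF' => /eqP FE.
have vv0 : v = v0.
  apply/eqP; apply: contraT => vv0.
  have /setP /(_ v0) := FE.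
  by rewrite !inE eqxx eq_sym vv0 Sv0.
by have := finset.setD1K (Sv0 _ FS); rewrite -FE vv0 finset.setD1K ?Sv0 // => ->.
Qed.

(** Rank-nullity reduces this to counting: among faces with [m.+1] vertices, those through [v0] give
    the rank of the outgoing boundary, and those that [v0] extends to a face give the rank of the
    incoming one. *)
Lemma reduced_betti_shifted (R : realFieldType) (n : nat)
    (K : {set {set 'I_n}}) (v0 : 'I_n) (m : nat) :
  (forall F v, F \in K -> v \in F -> (F :\ v)%SET \in K) ->
  (forall F v, F \in K -> v \in F -> v0 \notin F ->
     (v0 |: F :\ v)%SET \in K) ->
  reduced_betti R K m =
    #|[set F in faces K m.+1 | (v0 \notin F) && ((v0 |: F)%SET \notin K)]%SET|.
Proof.
move=> Kdown Kshift.
rewrite /reduced_betti mxrank_ker !(rank_boundary_shifted _ _ Kdown Kshift).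
set A := [set F in faces K m.+1 | v0 \in F]%SET.
set B := [set F in faces K m.+2 | v0 \in F]%SET.
set C := finset _.
pose D := [set F in faces K m.+1 | (v0 \notin F) && ((v0 |: F)%SET \in K)]%SET.
have BD : #|B| = #|D|.
  have -> : D = [set (F :\ v0)%SET | F in B].
    apply/setP => F; apply/idP/imsetP.
      rewrite !inE => /and3P[/andP[FK /eqP Fm] v0F v0FK].
      exists (v0 |: F)%SET; last by rewrite finset.setU1K.
      by rewrite !inE eqxx v0FK cardsU1 v0F Fm /= eqxx.
    move=> [G]; rewrite !inE => /andP[/andP[GK /eqP Gm] v0G] ->.
    rewrite !inE eqxx finset.setD1K // GK Kdown //=.
    by move: Gm; rewrite (cardsD1 v0) v0G add1n => -[->]; rewrite eqxx.
  rewrite card_in_imset // => F G; rewrite !inE => /andP[_ v0F] /andP[_ v0G] FG.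
  by rewrite -(finset.setD1K v0F) FG finset.setD1K.
have -> : #|faces K m.+1| = (#|A| + (#|D| + #|C|))%N.
  rewrite -(cardsID [set F : {set 'I_n} | v0 \in F]%SET (faces K m.+1)).
  congr (_ + _)%N.
    by apply: eq_card => F; rewrite !inE.
  rewrite -(cardsID [set F : {set 'I_n} | (v0 |: F)%SET \in K]%SET).
  congr (_ + _)%N.
    apply: eq_card => F; rewrite !inE.
    by do !case: (_ \in _) => //=; rewrite ?andbF ?andbT.
  apply: eq_card => F; rewrite !inE.
  by do !case: (_ \in _) => //=; rewrite ?andbF ?andbT.
by rewrite BD addKn addKn.
Qed.

(** Replacing a vertex by [v0] never increases the weight, and nonnegative weights make subsets of
    faces faces, so the previous count applies. *)
Lemma reduced_betti_quota (R : realFieldType) (n : nat) (w : 'I_n -> R) (q : R)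
    (v0 : 'I_n) (m : nat) :
  (forall v, 0 <= w v) -> (forall v, w v0 <= w v) ->
  reduced_betti R (quota_complex w q) m =
    #|[set F : {set 'I_n} | [&& v0 \notin F, #|F| == m.+1
         & q - w v0 <= \sum_(v in F) w v < q]]%SET|.
Proof.
move=> w0 wmin; rewrite (@reduced_betti_shifted _ _ _ v0).
- apply: eq_card => F; rewrite !inE.
  have [v0F|v0F] := boolP (v0 \in F); rewrite /= ?andbF //.
  rewrite big_setU1 //= -leNgt lerBlDl.
  by case: (_ < q); case: (#|F| == _); rewrite ?andbF ?andbT.
- move=> F v; rewrite !inE => FK vF; apply: le_lt_trans FK.
  by rewrite [leRHS](big_setD1 v) //= lerDr.
- move=> F v; rewrite !inE => FK vF v0F; apply: le_lt_trans FK.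
  rewrite [leRHS](big_setD1 v) //= big_setU1 ?lerD2r //.
  by rewrite !inE (negbTE v0F) andbF.
Qed.

(** * The expected Betti numbers *)

(** A preimage is a finite union of fibres of [K], so [V] can go without a sigma-algebra; it will be
    the type of complexes. *)
Lemma measurable_fun_finite_range (d d' : measure_display)
    (T : measurableType d) (U : measurableType d') (V : finType)
    (K : T -> V) (h : V -> U) :
  (forall c, measurable (K @^-1` [set c])%classic) ->
  measurable_fun [set: T] (h \o K).
Proof.
move=> mK _ Y _; rewrite setTI.
have -> : ((h \o K) @^-1` Y =
    \bigcup_(c in [set c | Y (h c)]) (K @^-1` [set c]))%classic.
  by apply/seteqP; split => [t Yt|t [c /= Yc Kt]]; [exists (K t)|rewrite /= Kt].
by apply: fin_bigcup_measurable => //; exact: finite_finset.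
Qed.

Lemma measurable_quota_complex (d : measure_display) (T : measurableType d)
    (R : realType) (n : nat) (w : 'I_n -> T -> R) (q : R)
    (K : {set {set 'I_n}}) :
  (forall v, measurable_fun [set: T] (w v)) ->
  measurable ((fun t => quota_complex (fun v => w v t) q) @^-1` [set K])%classic.
Proof.
move=> mw.
have -> : ((fun t => quota_complex (fun v => w v t) q) @^-1` [set K] =
    \bigcap_(F in [set: {set 'I_n}])
      (fun t => (\sum_(v in F) w v t < q)%R) @^-1` [set F \in K])%classic.
  apply/seteqP; split => t /=.
    by move=> <- F _ /=; rewrite inE.
  by move=> Kt; apply/setP => F; rewrite inE; exact: Kt.
apply: fin_bigcap_measurable => [|F _]; first exact: finite_finset.
rewrite -[X in measurable X]setTI.
have : measurable_fun [set: T] (fun t => (\sum_(v in F) w v t < q)%R).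
  apply: measurable_fun_ltr; last exact: measurable_cst.
  under eq_fun do rewrite big_mkcond.
  apply: measurable_sum => v; case: (v \in F); first exact: mw.
  exact: measurable_cst.
by apply.
Qed.

Lemma measurable_reduced_betti (d : measure_display) (T : measurableType d)
    (R : realType) (n : nat) (w : 'I_n -> T -> R) (q : R) (m : nat) :
  (forall v, measurable_fun [set: T] (w v)) ->
  measurable_fun [set: T] (fun t =>
    (reduced_betti R (quota_complex (fun v => w v t) q) m)%:R : R).
Proof.
move=> mw.
apply: (@measurable_fun_finite_range _ _ _ _ _ _
  (fun K : {set {set 'I_n}} => (reduced_betti R K m)%:R : R)) => K.
exact: measurable_quota_complex.
Qed.

(** * The law of a vector of independent Bernoulli variables *)

(** [is_bernoulli] fixes two point masses only; they add up to 1, so all other values form a null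
    event. *)
Lemma ae_bernoulli (d : measure_display) (T : measurableType d)
    (R : realType) (P : probability T R) (p : R) (X : {RV P >-> R}) :
  is_bernoulli p X -> {ae P, forall t, X t = (X t == 1)%:R}.
Proof.
move=> [X1 X0].
have m1 : measurable (X @^-1` [set 1])%classic by exact: measurable_sfunP.
have m0 : measurable (X @^-1` [set 0])%classic by exact: measurable_sfunP.
exists (~` (X @^-1` [set 1] `|` X @^-1` [set 0]))%classic; split.
- by apply: measurableC; exact: measurableU.
- rewrite probability_setC; last exact: measurableU.
  rewrite measureU //; last first.
    by rewrite -subset0 => t [/= -> /eqP]; rewrite oner_eq0.
  transitivity (1 - (p%:E + (1 - p)%:E))%E; first by rewrite -X1 -X0.
  by rewrite -EFinD [p + _]addrC subrK subrr.
- apply: subsetC => t /= [] -> /=; first by rewrite eqxx.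
  by rewrite eq_sym oner_eq0.
Qed.

Lemma bernoulli_vector_law (d : measure_display) (T : measurableType d)
    (R : realType) (P : probability T R) (p : R) (N : nat)
    (X : 'I_N -> {RV P >-> R}) (x : {ffun 'I_N -> bool}) :
  (forall j, is_bernoulli p (X j)) -> mutually_independent X ->
  P (\bigcap_(j in [set: 'I_N]) (X j @^-1` [set (x j)%:R]))%classic =
    (\prod_j (if x j then p else 1 - p))%:E.
Proof.
move=> hX hind.
have := hind [set: 'I_N]%SET (fun j => [set (x j)%:R])%classic.
have -> : ([set` [set: 'I_N]%SET] = [set: 'I_N])%classic.
  by apply/seteqP; split => j //= _; rewrite inE.
move=> -> //; rewrite -prodEFin; apply: eq_big => [j|j _]; first by rewrite inE.
by case: (x j); case: (hX j).
Qed.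

(** Almost surely all [X j] lie in {0, 1}, and there [f] is a finite combination of indicators of
    the events [A x]. *)
Lemma expectation_bernoulli_vector (d : measure_display) (T : measurableType d)
    (R : realType) (P : probability T R) (p : R) (N : nat)
    (X : 'I_N -> {RV P >-> R}) (f : T -> R) (g : {ffun 'I_N -> bool} -> R) :
  (forall j, is_bernoulli p (X j)) -> mutually_independent X ->
  measurable_fun [set: T] f -> (forall x, 0 <= g x) ->
  (forall t (x : {ffun 'I_N -> bool}),
    (forall j, X j t = (x j)%:R) -> f t = g x) ->
  ('E_P[f])%E = (\sum_x g x * \prod_j (if x j then p else 1 - p))%:E.
Proof.
move=> hX hind mf g0 fg.
pose A (x : {ffun 'I_N -> bool}) :=
  (\bigcap_(j in [set: 'I_N]) (X j @^-1` [set (x j)%:R]))%classic.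
have mA x : measurable (A x).
  apply: fin_bigcap_measurable => [|j _]; first exact: finite_finset.
  exact: measurable_sfunP.
have mgA x : measurable_fun [set: T] (fun t => (g x * \1_(A x) t)%:E).
  apply/measurable_EFinP/measurable_funM; first exact: measurable_cst.
  exact: measurable_indic.
rewrite unlock.
rewrite (@ae_eq_integral _ _ _ P setT
  (fun t => \sum_x (g x * \1_(A x) t)%:E)%E) //; first last.
- have : {ae P, forall t, forall j, X j t = (X j t == 1)%:R}.
    by apply: filter_forall => j; exact: ae_bernoulli (hX j).
  apply: filterS => t Xt _.
  pose x := [ffun j => X j t == 1].
  rewrite (fg t x); last by move=> j; rewrite ffunE.
  rewrite (bigD1 x) //= big1 => [|y yx].
    rewrite adde0 indicE mem_set ?mulr1 // => j _ /=.
    by rewrite ffunE.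
  rewrite indicE memNset ?mulr0 // => Ay.
  case/eqP: yx; apply/ffunP => j; rewrite ffunE (Ay j I).
  by case: (y j); rewrite ?eqxx // eq_sym oner_eq0.
- exact: emeasurable_sum.
- exact/measurable_EFinP.
rewrite ge0_integral_sum //; last by move=> x t _; rewrite lee_fin mulr_ge0.
rewrite -sumEFin; apply: eq_bigr => x _.
under eq_integral do rewrite EFinM.
rewrite ge0_integralZl_EFin //; last first.
  by apply/measurable_EFinP; exact: measurable_indic.
rewrite integral_indic // setIT EFinM; congr (_ * _)%E.
exact: bernoulli_vector_law.
Qed.

(* Compare the coefficients of 'X^j in (p 'X + (1 - p)) ^+ #|F|. *)
Lemma binomial_marginal (R : comNzRingType) (p : R) (N : nat) (F : {set 'I_N})
    (j : nat) :
  \sum_(x : {ffun 'I_N -> bool} | (\sum_(i in F) x i)%N == j)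
     \prod_i (if x i then p else 1 - p) =
  'C(#|F|, j)%:R * p ^+ j * (1 - p) ^+ (#|F| - j).
Proof.
(* ['X] marks the successes inside [F]; an index outside [F] contributes p + (1 - p) = 1. *)
pose c (i : 'I_N) (b : bool) : {poly R} :=
  if b then p *: (if i \in F then 'X else 1) else (1 - p)%:P.
have E : \prod_i \sum_b c i b = ((1 - p)%:P + p *: 'X) ^+ #|F|.
  rewrite -prodr_const [RHS]big_mkcond /=; apply: eq_bigr => i _.
  rewrite big_bool /c /=; case: (i \in F); first by rewrite addrC.
  by rewrite -mul_polyC mulr1 -polyCD addrC subrK.
have := congr1 (fun P : {poly R} => P`_j) E.
rewrite bigA_distr_bigA /= coef_sum exprDn coef_sum.
have -> : \sum_(x : {ffun 'I_N -> bool}) (\prod_i c i (x i))`_j =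
    \sum_(x : {ffun 'I_N -> bool} | (\sum_(i in F) x i)%N == j)
       \prod_i (if x i then p else 1 - p).
  rewrite [RHS]big_mkcond; apply: eq_bigr => x _.
  have -> : \prod_i c i (x i) =
      (\prod_i (if x i then p else 1 - p)) *: 'X^(\sum_(i in F) x i).
    rewrite -mul_polyC rmorph_prod expr_sum [X in _ * X]big_mkcond -big_split /=.
    apply: eq_bigr => i _; rewrite /c; case: (x i); case: (i \in F) => //=.
    - by rewrite mul_polyC expr1.
    - by rewrite mul_polyC.
    - by rewrite expr0 mulr1.
    - by rewrite mulr1.
  by rewrite coefZ coefXn eq_sym; case: eqP; rewrite ?mulr1 ?mulr0.
move=> ->.
have coefE (i : nat) : (((1 - p)%:P ^+ (#|F| - i) * (p *: 'X) ^+ i) *+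
    'C(#|F|, i))`_j =
    (j == i)%:R * ('C(#|F|, i)%:R * p ^+ i * (1 - p) ^+ (#|F| - i)).
  rewrite coefMn -rmorphXn /= exprZn coefCM coefZ coefXn -mulr_natl.
  by rewrite -(mulrC (p ^+ i)) !mulrA mulrC !mulrA; ring.
under eq_bigr do rewrite coefE.
have [jF|Fj] := leqP j #|F|.
  rewrite (bigD1 (Ordinal (jF : (j < #|F|.+1)%N))) //= eqxx mul1r big1 ?addr0 //.
  move=> i; rewrite -val_eqE /= eq_sym => /negbTE ->.
  by rewrite mul0r.
rewrite bin_small // !mul0r big1 // => i _.
by rewrite gtn_eqF ?mul0r // (leq_trans (ltn_ord i)).
Qed.

(* For [k = m + 1], the expectation of the reduced [m]-th Betti number. *)
Definition mean_betti (R : nzRingType) (p : R) (N q k : nat) : R :=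
  if (k < q)%N then
    'C(N, k)%:R * ('C(k, q.-1 - k)%:R * p ^+ (q.-1 - k) *
      (1 - p) ^+ (k - (q.-1 - k)))
  else 0.

Lemma card_sets_lift0 (N : nat) (Q : pred {set 'I_N.+1}) :
  #|[set F : {set 'I_N.+1} | (ord0 \notin F) && Q F]%SET| =
  #|[set F : {set 'I_N} | Q (lift ord0 @: F)%SET]%SET|.
Proof.
have inj : injective (fun F : {set 'I_N} => lift ord0 @: F)%SET.
  exact: imset_inj (@lift_inj _ ord0).
rewrite -(card_imset _ inj); apply: eq_card => F; rewrite inE.
apply/andP/imsetP => [[F0 QF]|[G]].
  have FE : F = (lift ord0 @: (lift ord0 @^-1: F))%SET.
    apply/setP => v; apply/idP/imsetP => [vF|[j]]; last by rewrite inE => ? ->.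
    case: (unliftP ord0 v) => [j vE|v0]; last by rewrite -v0 vF in F0.
    by exists j => //; rewrite inE -vE.
  by exists (lift ord0 @^-1: F)%SET; rewrite ?inE -?FE.
rewrite inE => QG ->; split => //.
by apply/imsetP => -[j _ /eqP]; rewrite eqE /= /bump.
Qed.

(** The weight of [F] is an integer in [q - 1, q), hence equals q - 1. *)
Lemma reduced_betti_bernoulli (R : realFieldType) (N q m : nat)
    (x : {ffun 'I_N -> bool}) :
  reduced_betti R
    (quota_complex (bernoulli_weight (fun j => (x j)%:R : R)) q%:R) m =
  #|[set F : {set 'I_N} | (#|F| == m.+1) &&
       ((m.+1 + \sum_(j in F) x j).+1 == q)%N]%SET|.
Proof.
have w0 : bernoulli_weight (fun j => (x j)%:R : R) ord0 = 1.
  by rewrite /bernoulli_weight unlift_none.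
have wl j : bernoulli_weight (fun j => (x j)%:R : R) (lift ord0 j) =
    1 + (x j)%:R.
  by rewrite /bernoulli_weight liftK.
have wge1 v : 1 <= bernoulli_weight (fun j => (x j)%:R : R) v.
  by case: (unliftP ord0 v) => [j|] ->; rewrite ?w0 // wl lerDl ler0n.
rewrite (@reduced_betti_quota _ _ _ _ ord0); first last.
- by move=> v; rewrite w0.
- by move=> v; rewrite (le_trans ler01).
rewrite (card_sets_lift0 (fun F => (#|F| == m.+1) &&
  (q%:R - _ <= \sum_(v in F) bernoulli_weight _ v < q%:R))).
apply: eq_card => F; rewrite !inE card_imset; last exact: lift_inj.
case: eqP => //= Fm; rewrite big_imset /=; last first.
  by move=> ? ? _ _; apply: lift_inj.
under eq_bigr do rewrite wl.
rewrite big_split /= sumr_const Fm -natr_sum -natrD w0 lerBlDr.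
by rewrite -[X in _ + X]/(1%:R) -natrD ler_nat ltr_nat addn1 -eqn_leq eq_sym.
Qed.

Lemma expected_bettiE (d : measure_display) (T : measurableType d)
    (R : realType) (P : probability T R) (p : R) (N : nat)
    (X : 'I_N -> {RV P >-> R}) (q m : nat) :
  (forall j, is_bernoulli p (X j)) -> mutually_independent X ->
  expected_betti X q m = (mean_betti p N q m.+1)%:E.
Proof.
move=> hX hind; rewrite /expected_betti.
rewrite (@expectation_bernoulli_vector _ _ _ _ p _ X _ (fun x =>
  (reduced_betti R (quota_complex
     (bernoulli_weight (fun j => (x j)%:R : R)) q%:R) m)%:R)) //; first last.
- move=> t x Xt.
  by have -> : (fun j => X j t) = (fun j => (x j)%:R) by apply/funext.
- apply: (measurable_reduced_betti
    (w := fun v t => bernoulli_weight (fun j => X j t) v)) => v.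
  rewrite /bernoulli_weight; case: (unlift ord0 v) => [j|]; last first.
    exact: measurable_cst.
  by apply: measurable_funD; [exact: measurable_cst|exact: measurable_funP].
congr EFin.
under eq_bigr => x _ do
  rewrite reduced_betti_bernoulli -sum1_card natr_sum mulr_suml big_mkcond.
(* After the exchange, each [F] with [m.+1] elements contributes the probability that its total
   weight is q - 1. *)
rewrite exchange_big /=.
rewrite (eq_bigr (fun F : {set 'I_N} => if #|F| == m.+1 then
    if (m.+1 < q)%N then 'C(m.+1, q.-1 - m.+1)%:R * p ^+ (q.-1 - m.+1) *
      (1 - p) ^+ (m.+1 - (q.-1 - m.+1)) else 0 else 0)).
  rewrite -big_mkcond sumr_const (_ : #|_| = 'C(N, m.+1)); last first.
    rewrite -[N in RHS]card_ord -card_draws.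
    by apply: eq_card => F; rewrite !inE.
  by rewrite /mean_betti; case: (m.+1 < q)%N; rewrite ?mul0rn // [RHS]mulr_natl.
move=> F _.
have [Fm|Fm] := eqVneq #|F| m.+1; last first.
  by apply: big1 => x _; rewrite inE (negbTE Fm).
(* For [m.+1 >= q] no such [F] weighs q - 1, whereas the truncated [q.-1 - m.+1] would be 0 and
   could give a nonzero term; hence the guard in [mean_betti]. *)
have [mq|qm] := ltnP m.+1 q; last first.
  by apply: big1 => x _; rewrite inE ifN //; apply/negP => /andP[_ /eqP]; lia.
rewrite -[in RHS]Fm -binomial_marginal [RHS]big_mkcond; apply: eq_bigr => x _.
rewrite inE Fm eqxx /= mul1r; congr (if _ then _ else _).
by apply/eqP/eqP; lia.
Qed.

(** * The location of the mode *)

Lemma mean_betti_gt0 (R : realFieldType) (p : R) (N q k : nat) :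
  0 < p -> p < 1 ->
  (0 < mean_betti p N q k) = [&& (k <= N), (k < q) & (q <= k.*2.+1)]%N.
Proof.
move=> p0 p1; rewrite /mean_betti; have [kq|qk] := ltnP k q; last first.
  by rewrite ltxx andbF.
have pbar0 : 0 < 1 - p by rewrite subr_gt0.
rewrite -!mulrA mulrA -natrM pmulr_lgt0 ?mulr_gt0 ?exprn_gt0 // ltr0n muln_gt0.
by rewrite !bin_gt0 /=; congr (_ && _); lia.
Qed.

(** Stated without division, so that it also covers indices where the values or the factors vanish.
    Inside the support it follows from three recurrences for binomial coefficients. *)
Lemma mean_betti_ratio (R : realFieldType) (p : R) (N q k : nat) :
  (k.+1 < q)%N -> (k <= N)%N ->
  mean_betti p N q k.+1 *
    (p * (2 * k%:R - q%:R + 2) * (2 * k%:R - q%:R + 3)) =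
  mean_betti p N q k * ((1 - p) ^+ 2 * (N%:R - k%:R) * (q%:R - 1 - k%:R)).
Proof.
move=> kq kN; rewrite /mean_betti kq (ltnW kq).
have [j qE] : exists j, q = (k + j).+2 by exists (q - k.+2)%N; lia.
have -> : (q.-1 - k.+1 = j)%N by lia.
have -> : (q.-1 - k = j.+1)%N by lia.
have -> : q%:R = k%:R + j%:R + 2 :> R by rewrite qE -!natrD addn2.
have -> : 2 * k%:R - (k%:R + j%:R + 2) + 2 = k%:R - j%:R :> R by ring.
have -> : 2 * k%:R - (k%:R + j%:R + 2) + 3 = k.+1%:R - j%:R :> R.
  by rewrite -natr1; ring.
have -> : k%:R + j%:R + 2 - 1 - k%:R = j.+1%:R :> R by rewrite -natr1; ring.
(* Here both sides vanish: a binomial coefficient is 0, or one of the factors k - j and k + 1 - j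
   is. *)
have [kj|jk] := leqP k j.
  have [->|kj'] := eqVneq j k.
    by rewrite subrr (@bin_small k) // !(mulr0, mul0r).
  rewrite (@bin_small k j.+1); last by lia.
  have [->|kj''] := eqVneq j k.+1; first by rewrite subrr !(mulr0, mul0r).
  by rewrite (@bin_small k.+1 j) ?(mulr0, mul0r) //; lia.
have bN : k.+1%:R * 'C(N, k.+1)%:R = (N%:R - k%:R) * 'C(N, k)%:R :> R.
  by rewrite -natrB // -!natrM mul_bin_left.
have bk : (k.+1%:R - j%:R) * 'C(k.+1, j)%:R = k.+1%:R * 'C(k, j)%:R :> R.
  by rewrite -natrB -?natrM -?mul_bin_down //; lia.
have bj : (k%:R - j%:R) * 'C(k, j)%:R = j.+1%:R * 'C(k, j.+1)%:R :> R.
  by rewrite -natrB -?natrM -?mul_bin_left //; lia.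
have -> : (k.+1 - j = (k - j.+1).+2)%N by lia.
rewrite !exprS -[in RHS](expr1 (1 - p)) ?expr1.
set e := (1 - p) ^+ (k - j.+1); set P := p ^+ j.
have k0 : k.+1%:R != 0 :> R by rewrite pnatr_eq0.
apply: (mulfI k0).
transitivity ((k.+1%:R * 'C(N, k.+1)%:R) *
  ((k.+1%:R - j%:R) * 'C(k.+1, j)%:R) * (k%:R - j%:R) *
  (p * P * (1 - p) ^+ 2 * e)); first by ring.
rewrite bN bk.
transitivity ((N%:R - k%:R) * 'C(N, k)%:R * k.+1%:R *
  ((k%:R - j%:R) * 'C(k, j)%:R) * (p * P * (1 - p) ^+ 2 * e)); first by ring.
by rewrite bj; ring.
Qed.

(* At a mode [k] the ratio of consecutive values crosses 1. *)
Lemma mean_betti_mode (R : realFieldType) (p : R) (N q k : nat) :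
  0 < p -> p < 1 -> (1 < k)%N -> 0 < mean_betti p N q k ->
  mean_betti p N q k.-1 <= mean_betti p N q k ->
  mean_betti p N q k.+1 <= mean_betti p N q k ->
  (1 - p) ^+ 2 * (N%:R - k%:R) * (q%:R - 1 - k%:R) <=
    p * (2 * k%:R - q%:R + 2) * (2 * k%:R - q%:R + 3) /\
  p * (2 * k%:R - q%:R) * (2 * k%:R - q%:R + 1) <=
    (1 - p) ^+ 2 * (N%:R - k%:R + 1) * (q%:R - k%:R).
Proof.
move=> p0 p1 k1 a0 le_pred le_succ.
move: (a0); rewrite mean_betti_gt0 // => /and3P[kN kq qk].
have qkR : q%:R <= 2 * k%:R + 1 :> R.
  by rewrite -natrM natr1 ler_nat; lia.
split.
  have [kq1|kq1] := ltnP k.+1 q; last first.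
    have -> : q%:R - 1 - k%:R = 0 :> R.
      have -> : q = k.+1 by lia.
      by rewrite -natr1; ring.
    by rewrite mulr0 !mulr_ge0 ?ltW //; lra.
  rewrite -(ler_pM2l a0) -mean_betti_ratio //; apply: ler_wpM2r => //.
  by rewrite !mulr_ge0 ?ltW //; lra.
have kE : k = k.-1.+1 by lia.
have kR : k%:R = k.-1%:R + 1 :> R by rewrite natr1 -kE.
rewrite -(ler_pM2l a0).
have := @mean_betti_ratio _ p N q k.-1; rewrite -kE => /(_ kq) E.
have -> : 2 * k%:R - q%:R = 2 * k.-1%:R - q%:R + 2 :> R by rewrite kR; ring.
have -> : 2 * k.-1%:R - q%:R + 2 + 1 = 2 * k.-1%:R - q%:R + 3 :> R by ring.
rewrite E; last by lia.
have -> : N%:R - k%:R + 1 = N%:R - k.-1%:R :> R by rewrite kR; ring.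
have -> : q%:R - k%:R = q%:R - 1 - k.-1%:R :> R by rewrite kR; ring.
apply: ler_wpM2r => //.
apply: mulr_ge0.
  by apply: mulr_ge0; rewrite ?sqr_ge0 // subr_ge0 ler_nat; lia.
by rewrite subr_ge0 lerBrDr natr1 ler_nat; lia.
Qed.

(** Times q^2 the quadratic is (1-p)^2 (dq - k)(q - k) - p (2k - q)^2; the mode inequalities bound
    this on both sides up to terms linear in q. *)
Lemma peak_quadratic_mode (R : realType) (d p : R) (N q k : nat) :
  0 < d -> 0 < p -> p < 1 -> (0 < q)%N ->
  `|N.+1%:R - d * q%:R| < 1 -> (k < q)%N -> (q <= k.*2.+1)%N ->
  (1 - p) ^+ 2 * (N%:R - k%:R) * (q%:R - 1 - k%:R) <=
    p * (2 * k%:R - q%:R + 2) * (2 * k%:R - q%:R + 3) ->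
  p * (2 * k%:R - q%:R) * (2 * k%:R - q%:R + 1) <=
    (1 - p) ^+ 2 * (N%:R - k%:R + 1) * (q%:R - k%:R) ->
  `|peak_quadratic d p (k%:R / q%:R)| <= (d + 20) / q%:R.
Proof.
move=> d0 p0 p1 q0 hN kq qk ub lb.
have qR : 0 < q%:R :> R by rewrite ltr0n.
have q1 : 1 <= q%:R :> R by rewrite ler1n.
have kqR : k%:R + 1 <= q%:R :> R by rewrite natr1 ler_nat.
have qkR : q%:R <= 2 * k%:R + 1 :> R by rewrite -natrM natr1 ler_nat; lia.
have k0 : 0 <= k%:R :> R by [].
move: hN; rewrite -natr1 ltr_norml => /andP[hN1 hN2].
have -> : peak_quadratic d p (k%:R / q%:R) =
    ((1 - p) ^+ 2 * (d * q%:R - k%:R) * (q%:R - k%:R) -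
      p * (2 * k%:R - q%:R) ^+ 2) / q%:R ^+ 2.
  by rewrite /peak_quadratic /=; field; rewrite gt_eqF.
have -> : (d + 20) / q%:R = (d + 20) * q%:R / q%:R ^+ 2.
  by field; rewrite gt_eqF.
rewrite normrM [`|_^-1|]gtr0_norm ?invr_gt0 ?exprn_gt0 //.
rewrite ler_pM2r ?invr_gt0 ?exprn_gt0 //.
pose s := (1 - p) ^+ 2; rewrite -/s in ub lb *.
have s0 : 0 <= s by rewrite exprn_ge0 // subr_ge0 ltW.
have s1 : s <= 1 by rewrite expr_le1 // ?subr_ge0; lra.
(* [e] collects the rounding of dq and the shift from N + 1 to N; it stays in [-2, 0]. *)
pose e := N%:R - d * q%:R : R.
have NE : N%:R = d * q%:R + e by rewrite /e; ring.
have e0 : e <= 0 by rewrite /e; lra.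
have e2 : - 2 <= e by rewrite /e; lra.
rewrite NE in ub lb.
pose A : R := d * q%:R - k%:R; pose B : R := q%:R - k%:R.
pose D : R := 2 * k%:R - q%:R.
have B0 : 0 <= B <= q%:R by rewrite /B; lra.
have D0 : - 1 <= D <= q%:R by rewrite /D; lra.
have dq0 : 0 <= d * q%:R by rewrite mulr_ge0 // ltW.
have A0 : A <= d * q%:R by rewrite /A; lra.
rewrite -/A -/B -/D in ub lb *.
have {}ub : s * (A + e) * (B - 1) <= p * (D + 2) * (D + 3).
  by rewrite /A /B; lra.
have {}lb : p * D * (D + 1) <= s * (A + e + 1) * B by rewrite /A; lra.
have sA : s * A <= d * q%:R.
  have [A0'|A0'] := lerP 0 A; first by rewrite (le_trans _ A0) // ler_piMl.
  by rewrite (le_trans _ dq0) // mulr_ge0_le0 // ltW.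
have seB : - (2 * q%:R) <= s * e * B.
  have : 0 <= s * - e <= 2.
    by rewrite mulr_ge0 ?oppr_ge0 //= -[2]mul1r ler_pM // ?oppr_ge0; lra.
  by move: B0 => /andP[? ?] /andP[? ?]; nra.
have seB' : s * e * B <= 0 by rewrite mulr_le0_ge0 ?mulr_ge0_le0 //; lra.
have se : s * e <= 0 by rewrite mulr_ge0_le0.
have sB : 0 <= s * B <= q%:R.
  by rewrite mulr_ge0 /= ?(le_trans (ler_piMl _ s1)) //; lra.
have pD : - 1 <= p * D <= q%:R by move: D0 => /andP[? ?]; apply/andP; split; nra.
rewrite ler_norml; apply/andP; split.
  suff : - (2 * q%:R) <= s * A * B - p * D ^+ 2 by nra.
  have -> : s * A * B - p * D ^+ 2 = (s * (A + e + 1) * B - p * D * (D + 1)) +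
      (p * D - s * e * B - s * B) by ring.
  by lra.
(* The first difference is nonpositive by [ub]; the remaining terms add up to at most (d + 13) q, so
   the constant d + 20 leaves slack. *)
have -> : s * A * B - p * D ^+ 2 =
  (s * (A + e) * (B - 1) - p * (D + 2) * (D + 3)) +
  (s * A + s * e - s * e * B + 5 * (p * D) + 6 * p) by ring.
by lra.
Qed.

(** * The root of the peak quadratic between 1/2 and 1 *)

Lemma peak_quadratic_half (R : realType) (d p : R) :
  peak_quadratic d p (1 / 2) = (1 - p) ^+ 2 * (d - 1 / 2) / 2.
Proof. by rewrite /peak_quadratic /=; field. Qed.

Lemma peak_quadratic1 (R : realType) (d p : R) : peak_quadratic d p 1 = - p.
Proof. by rewrite /peak_quadratic /=; ring. Qed.

(** The divided difference of the quadratic between [r] and [t], written as a polynomial so that it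
    makes sense at [t = r]. *)
Definition peak_slope (R : realType) (d p r t : R) : R :=
  ((1 - p) ^+ 2 - 4 * p) * (t + r) + (4 * p - (1 - p) ^+ 2 * (d + 1)).

Lemma peak_quadraticB (R : realType) (d p r t : R) :
  peak_quadratic d p t - peak_quadratic d p r = (t - r) * peak_slope d p r t.
Proof. by rewrite /peak_quadratic /peak_slope /=; ring. Qed.

Lemma peak_root_exists (R : realType) (d p : R) :
  1 / 2 < d -> 0 < p -> p < 1 ->
  exists r, [/\ 1 / 2 < r, r < 1 & peak_quadratic d p r = 0].
Proof.
move=> hd p0 p1.
(* Negated, because [poly_ivt] wants a change from nonpositive to nonnegative. *)
pose P : {poly R} := - (((1 - p) ^+ 2 - 4 * p) *: 'X^2 +
  (4 * p - (1 - p) ^+ 2 * (d + 1)) *: 'X + ((1 - p) ^+ 2 * d - p)%:P).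
have PE t : P.[t] = - peak_quadratic d p t.
  by rewrite /P !hornerE /peak_quadratic /=; ring.
have half0 : 0 < peak_quadratic d p (1 / 2).
  by rewrite peak_quadratic_half divr_gt0 // mulr_gt0 ?exprn_gt0 // subr_gt0.
have [||r /andP[r1 r2] /eqP] := @poly_ivt R P (1 / 2) 1.
- by lra.
- by rewrite !PE peak_quadratic1 opprK oppr_le0 !ltW.
rewrite PE => /eqP; rewrite oppr_eq0 => /eqP r0; exists r; split => //.
  by rewrite lt_neqAle r1 andbT; apply: contraTneq half0 => ->; rewrite r0 ltxx.
rewrite lt_neqAle r2 andbT; apply: contraTneq p0 => rE.
move: r0; rewrite rE peak_quadratic1 => /eqP.
by rewrite oppr_eq0 => /eqP ->; rewrite ltxx.
Qed.

(* The slope is affine in [t] and negative at both ends of the interval. *)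
Lemma peak_slope_lt0 (R : realType) (d p r : R) :
  1 / 2 < d -> 0 < p -> p < 1 -> 1 / 2 < r -> r < 1 ->
  peak_quadratic d p r = 0 ->
  exists2 c, 0 < c &
    forall t, 1 / 2 <= t -> t <= 1 -> peak_slope d p r t <= - c.
Proof.
move=> hd p0 p1 r1 r2 r0.
have half0 : 0 < peak_quadratic d p (1 / 2).
  by rewrite peak_quadratic_half divr_gt0 // mulr_gt0 ?exprn_gt0 // subr_gt0.
have L1 : peak_slope d p r (1 / 2) < 0.
  have := peak_quadraticB d p r (1 / 2); rewrite r0 subr0 => E.
  by move: half0; rewrite E nmulr_rgt0 // subr_lt0.
have L2 : peak_slope d p r 1 < 0.
  have := peak_quadraticB d p r 1; rewrite r0 subr0 peak_quadratic1 => E.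
  by rewrite -(pmulr_rlt0 _ (_ : 0 < 1 - r)) ?subr_gt0 // -E oppr_lt0.
exists (Num.min (- peak_slope d p r (1 / 2)) (- peak_slope d p r 1)).
  by rewrite lt_min !oppr_gt0 L1.
move=> t t1 t2; set c := Num.min _ _.
have c1 : peak_slope d p r (1 / 2) <= - c by rewrite lerNr ge_min lexx.
have c2 : peak_slope d p r 1 <= - c by rewrite lerNr ge_min lexx orbT.
have -> : peak_slope d p r t = (2 - 2 * t) * peak_slope d p r (1 / 2) +
    (2 * t - 1) * peak_slope d p r 1.
  by rewrite /peak_slope; field.
have : (2 - 2 * t) * peak_slope d p r (1 / 2) <= (2 - 2 * t) * - c.
  by apply: ler_wpM2l => //; lra.
have : (2 * t - 1) * peak_slope d p r 1 <= (2 * t - 1) * - c.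
  by apply: ler_wpM2l => //; lra.
by lra.
Qed.

(** A slope bounded away from 0 turns a small value of the quadratic into a small distance to the
    root. *)
Lemma peak_root_dist (R : realType) (d p r : R) :
  1 / 2 < d -> 0 < p -> p < 1 -> 1 / 2 < r -> r < 1 ->
  peak_quadratic d p r = 0 ->
  exists M, exists Q0 : nat, forall q k : nat, (Q0 <= q)%N -> (0 < q)%N ->
    (k < q)%N -> (q <= k.*2.+1)%N ->
    `|peak_quadratic d p (k%:R / q%:R)| <= (d + 20) / q%:R ->
    `|k%:R / q%:R - r| <= M / q%:R.
Proof.
move=> hd p0 p1 r1 r2 r0.
have [c c0 cP] := peak_slope_lt0 hd p0 p1 r1 r2 r0.
pose a := (1 - p) ^+ 2 - 4 * p.
(* The threshold gives |a| / q <= c, so that the shift by 1 / (2q) below costs at most half of the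
   slope bound [c]. *)
exists ((d + 20) / (c / 2)), (Num.truncn (`|a| / c)).+1 => q k Qq q0 kq qk H.
have qR : 0 < q%:R :> R by rewrite ltr0n.
have kqR : k%:R + 1 <= q%:R :> R by rewrite natr1 ler_nat.
have qkR : q%:R <= 2 * k%:R + 1 :> R by rewrite -natrM natr1 ler_nat; lia.
set t := k%:R / q%:R in H *.
(* [t] may lie just below 1/2, so the slope is compared at a shifted point. *)
pose t' := t + 1 / 2 / q%:R.
have t'1 : 1 / 2 <= t'.
  by rewrite /t' /t -mulrDl ler_pdivlMr //; lra.
have t'2 : t' <= 1 by rewrite /t' /t -mulrDl ler_pdivrMr //; lra.
have L : peak_slope d p r t <= - (c / 2).
  have -> : peak_slope d p r t = peak_slope d p r t' - a / q%:R / 2.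
    by rewrite /peak_slope /t' /a; field; rewrite gt_eqF.
  have := cP _ t'1 t'2.
  have : `|a| / q%:R <= c.
    rewrite ler_pdivrMr // mulrC -ler_pdivrMr //.
    by rewrite (le_trans (ltW (truncnS_gt _))) // ler_nat.
  have : - (a / q%:R) <= `|a| / q%:R.
    by rewrite -mulNr ler_pM2r ?invr_gt0 // -normrN ler_norm.
  by lra.
have E := peak_quadraticB d p r t; rewrite r0 subr0 in E.
rewrite E normrM in H.
have L' : c / 2 <= `|peak_slope d p r t|.
  by rewrite ler0_norm; lra.
have c20 : 0 < c / 2 by rewrite divr_gt0.
have -> : (d + 20) / (c / 2) / q%:R = (d + 20) / q%:R / (c / 2).
  by rewrite -!mulrA [_ / q%:R]mulrC.
rewrite ler_pdivlMr //; apply: le_trans H.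
exact: ler_wpM2l.
Qed.

(** As dq need not be an integer, N + 1 = dq is read as a distance below 1, which allows either
    rounding. Convergence is asserted separately since [limn] is total. *)
Theorem theorem5p1 (R : realType) (d p : R)
    (hd : 1 / 2 < d) (hp0 : 0 < p) (hp1 : p < 1)
    (N : nat -> nat)
    (hN : forall q : nat, (0 < q)%N -> `|(N q).+1%:R - d * q%:R| < 1)
    (disp : nat -> measure_display)
    (T : forall q : nat, measurableType (disp q))
    (P : forall q : nat, probability (T q) R)
    (X : forall q : nat, 'I_(N q) -> {RV (P q) >-> R})
    (hX : forall (q : nat) (j : 'I_(N q)), is_bernoulli p (X q j))
    (hXind : forall q : nat, mutually_independent (X q))
    (m_peak : nat -> nat)
    (hm : forall q : nat, (0 < q)%N ->
       is_mode (expected_betti (X q) q) (m_peak q)) :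
  let tau_peak : nat -> R := fun q => (m_peak q).+1%:R / q%:R in
  let tau_inf : R := limn tau_peak in
  [/\ cvgn tau_peak,
      p != 3 - Num.sqrt 8 ->
        [/\ 1 / 2 <= tau_inf, tau_inf < 1, peak_quadratic d p tau_inf = 0
          & forall t : R, 1 / 2 <= t -> t < 1 ->
              peak_quadratic d p t = 0 -> t = tau_inf]
    & p = 3 - Num.sqrt 8 -> tau_inf = (4 * d - 1) / (4 * d)].
Proof.
have [r [r1 r2 r0]] := peak_root_exists hd hp0 hp1.
have d0 : 0 < d by lra.
have [M [Q0 near_r]] := peak_root_dist hd hp0 hp1 r1 r2 r0.
(* From [Q1] on, (d - 1/2) q >= 2, so N > dq - 2 >= q / 2 and the index [q./2] lies in the support
   of [mean_betti]. *)
pose Q1 := (Num.truncn (2 / (d - 1 / 2))).+1.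
have dist_tau q : (maxn 4 (maxn Q0 Q1) <= q)%N ->
    `|(m_peak q).+1%:R / q%:R - r| <= M / q%:R.
  rewrite !geq_max => /and3P[q4 qQ0 qQ1].
  have q0 : (0 < q)%N by lia.
  have qN : (q./2 <= N q)%N.
    have := hN q q0; rewrite ltr_norml => /andP[hNq _].
    have : 2 / (d - 1 / 2) <= q%:R.
      by rewrite (le_trans (ltW (truncnS_gt _))) // ler_nat.
    rewrite ler_pdivrMr ?subr_gt0 // => h.
    have : (q./2)%:R * 2 <= q%:R :> R by rewrite -natrM ler_nat; lia.
    have : (N q)%:R + 1 = (N q).+1%:R :> R by rewrite natr1.
    by rewrite -(ler_nat R); lra.
  have mode k : (0 < k)%N ->
      mean_betti p (N q) q k <= mean_betti p (N q) q (m_peak q).+1.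
    move=> k0; have := hm q q0 k.-1.
    by rewrite !(expected_bettiE _ _ (hX q) (hXind q)) lee_fin prednK.
  have a0 : 0 < mean_betti p (N q) q (m_peak q).+1.
    apply: lt_le_trans (mode q./2 _); last by lia.
    by rewrite mean_betti_gt0 // qN /=; lia.
  move: (a0); rewrite mean_betti_gt0 // => /and3P[kN kq qk].
  (* This uses q >= 4: both neighbours of the mode must be indices k = m + 1 with m >= 0. *)
  have k1 : (1 < (m_peak q).+1)%N by lia.
  have [ub lb] := mean_betti_mode hp0 hp1 k1 a0 
    (mode (m_peak q) k1) (mode (m_peak q).+2 isT).
  apply: near_r => //.
  exact: peak_quadratic_mode (hN q q0) kq qk ub lb.
move=> tau_peak tau_inf.
have tau_cvg : (tau_peak @ \oo --> r)%classic.
  apply/cvgrPdist_le => e e0.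
  exists (maxn (maxn 4 (maxn Q0 Q1)) (Num.truncn (M / e)).+1) => // q /=.
  rewrite geq_max => /andP[qQ qM].
  have qR : 0 < q%:R :> R by rewrite ltr0n; lia.
  rewrite distrC (le_trans (dist_tau q qQ)) // ler_pdivrMr // mulrC.
  by rewrite -ler_pdivrMr // (le_trans (ltW (truncnS_gt _))) // ler_nat.
have -> : tau_inf = r by apply: cvg_lim tau_cvg.
split.
- by apply/cvg_ex; exists r.
- move=> _; split => //; first exact: ltW.
  (* A second root would make the slope vanish inside [1/2, 1]. *)
  move=> t t1 t2 t0; apply/eqP; rewrite -subr_eq0.
  have [c c0 cP] := peak_slope_lt0 hd hp0 hp1 r1 r2 r0.
  have := peak_quadraticB d p r t; rewrite t0 r0 subrr => /esym/eqP.
  rewrite mulf_eq0 => /orP[//|/eqP L0].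
  by have := cP t t1 (ltW t2); rewrite L0; lra.
(* This value of [p] cancels the leading coefficient (1-p)^2 - 4p; the linear equation left over is
   p (4d - 1 - 4d r) = 0. *)
- move=> pE.
  have p2 : (1 - p) ^+ 2 = 4 * p.
    have h : (3 - p) ^+ 2 = 8 by rewrite pE subKr sqr_sqrtr.
    have -> : (1 - p) ^+ 2 = (3 - p) ^+ 2 - 8 + 4 * p by ring.
    by rewrite h subrr add0r.
  move: r0; rewrite /peak_quadratic /= p2 => E.
  apply: (mulIf (_ : 4 * d != 0)); first by rewrite mulf_neq0 ?gt_eqF.
  rewrite divfK; last by rewrite mulf_neq0 ?gt_eqF.
  apply: (mulfI (_ : p != 0)); first by rewrite gt_eqF.
  by move: E; lra.
Qed.
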